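(* Suppose $D$ is an unbounded, essentially self-adjoint operator on a Hilbert space $\mathcal{H}$, and $T\in\mathcal{B}(\mathcal{H})$ preserves $\operatorname{dom}D$ and satisfies $TD=-DT$. If $f\in C_b(\mathbb{R})$ is odd, then $Tf(D)=-f(D)T$, and if $f$ is even, then $Tf(D)=f(D)T$.
   Context: $D$ is densely defined; essentially self-adjoint means that $D$ is symmetric and $\operatorname{dom}\overline D=\operatorname{dom}D^*$ ($\overline D$ the closure, $D^*$ the adjoint). The identity $TD=-DT$ is understood on $\operatorname{dom}D$. $C_b(\mathbb{R})$ is the algebra of bounded continuous complex-valued functions on $\mathbb{R}$, and $f(D)$ is defined by Borel functional calculus for the self-adjoint operator $\overline D$. *)

(* Defs.v *)
From HB Require Import structures.
From mathcomp Require Import all_boot all_order all_algebra.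
From mathcomp Require Import sesquilinear.
From mathcomp Require Import all_classical all_reals all_analysis.
From mathcomp Require Import complex.

Set Implicit Arguments.
Unset Strict Implicit.
Unset Printing Implicit Defensive.

Import Order.TTheory GRing.Theory Num.Theory.
Import numFieldNormedType.Exports.

Local Open Scope classical_set_scope.
Local Open Scope ring_scope.

(* MathComp-Analysis topologizes abstract numeric fields; this transports the
   modulus topology to the concrete type R[i]. *)
HB.instance Definition _ (R : realType) :=
  NormedModule.copy R[i] ((R[i] : numClosedFieldType)^o).

(* The inner product is linear in its first argument and conjugate-linear in
   the second. *)
Record hilbertSpace (R : realType) := HilbertSpace {
  hilbert_sort :> completeNormedModType R[i];
  hilbert_dot : {dot hilbert_sort for Num.conj};
  hilbert_norm : forall x : hilbert_sort, hilbert_dot x x = `|x| ^+ 2 }.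

Section inner_product.
Context {R : realType} {H : hilbertSpace R}.
Implicit Types x y z : H.

Definition inner x y : R[i] := hilbert_dot H x y.

Lemma inner_norm x : inner x x = `|x| ^+ 2.
Proof. exact: hilbert_norm. Qed.

Lemma innerC x y : inner x y = (inner y x)^*.
Proof. by rewrite [LHS]hermitian_subproof expr0 mul1r. Qed.

Lemma innerDl x y z : inner (x + y) z = inner x z + inner y z.
Proof. exact: linearDl. Qed.

Lemma innerDr x y z : inner x (y + z) = inner x y + inner x z.
Proof. exact: linearDr. Qed.

Lemma innerZl a x y : inner (a *: x) y = a * inner x y.
Proof. exact: linearZl_LR. Qed.

Lemma innerZr a x y : inner x (a *: y) = a^* * inner x y.
Proof. by rewrite innerC innerZl (innerC x y); exact: rmorphM. Qed.

Lemma inner0l x : inner 0 x = 0.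
Proof. exact: linear0l. Qed.

Lemma inner0r x : inner x 0 = 0.
Proof. exact: linear0r. Qed.

Lemma inner_suml (I : Type) (r : seq I) (P : pred I) (u : I -> H) x :
  inner (\sum_(i <- r | P i) u i) x = \sum_(i <- r | P i) inner (u i) x.
Proof. exact: linear_sumlz. Qed.

Lemma norm2D_ortho x y :
  inner x y = 0 -> `|x + y| ^+ 2 = `|x| ^+ 2 + `|y| ^+ 2.
Proof.
move=> xy0; rewrite -!inner_norm innerDl !innerDr (innerC y x) xy0 rmorph0.
by rewrite addr0 add0r.
Qed.

End inner_product.

Section unbounded_operators.
Context {R : realType} {H : hilbertSpace R}.

(* The values of opfun outside dom are irrelevant. *)
Record operator := Operator {
  dom : set H;
  opfun :> H -> H;
  dom0 : dom 0;
  domP : forall (a : R[i]) (x y : H), dom x -> dom y -> dom (a *: x + y);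
  opfunP : forall (a : R[i]) (x y : H), dom x -> dom y ->
    opfun (a *: x + y) = a *: opfun x + opfun y }.

Definition graph (D : operator) : set (H * H) :=
  [set p | dom D p.1 /\ D p.1 = p.2].

Definition graph_dom (G : set (H * H)) : set H :=
  [set x | exists y, G (x, y)].

Definition closure_graph (D : operator) : set (H * H) := closure (graph D).

Definition adjoint_graph (D : operator) : set (H * H) :=
  [set p | forall x, dom D x -> inner (D x) p.1 = inner x p.2].

Definition symmetric (D : operator) :=
  forall x y, dom D x -> dom D y -> inner (D x) y = inner x (D y).

Definition essentially_self_adjoint (D : operator) :=
  symmetric D /\ graph_dom (closure_graph D) = graph_dom (adjoint_graph D).

End unbounded_operators.
Arguments operator {R} H.

Section spectral_measures.
Context {R : realType} {H : hilbertSpace R}.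

Definition orthogonal_projection (P : H -> H) :=
  [/\ linear P, forall x, P (P x) = P x
    & forall x y, inner (P x) y = inner x (P y)].

(* Only the values of pvm_fun on Borel sets are relevant. *)
Record projection_valued_measure := ProjectionValuedMeasure {
  pvm_fun :> set R -> H -> H;
  pvm_proj : forall A, measurable A -> orthogonal_projection (pvm_fun A);
  pvm0 : forall x, pvm_fun set0 x = 0;
  pvmT : forall x, pvm_fun setT x = x;
  pvmI : forall A B, measurable A -> measurable B ->
    forall x, pvm_fun (A `&` B) x = pvm_fun A (pvm_fun B x);
  pvm_sigma_additive : forall A : (set R)^nat,
    (forall n, measurable (A n)) -> trivIset setT A ->
    forall x, (fun n => \sum_(0 <= k < n) pvm_fun (A k) x) @ \oo -->
              pvm_fun (\bigcup_k A k) x }.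

Variable E : projection_valued_measure.

(* For A Borel, this is <E(A)x, x>, because E(A) is an orthogonal projection. *)
Definition scalar_measure (x : H) (A : set R) : \bar R :=
  (complex.Re (`|E A x| ^+ 2))%:E.

Fact scalar_measure0 x : scalar_measure x set0 = 0%E.
Proof. by rewrite /scalar_measure pvm0 normr0 expr0n. Qed.

Fact scalar_measure_ge0 x A : (0 <= scalar_measure x A)%E.
Proof.
rewrite /scalar_measure lee_fin.
by have: 0 <= `|E A x| ^+ 2 by []; rewrite lecE => /andP[].
Qed.

Lemma pvm_inner A x : measurable A -> inner (E A x) x = `|E A x| ^+ 2.
Proof.
move=> mA; have [_ EE Es] := pvm_proj E mA.
by rewrite -inner_norm -Es EE.
Qed.

Lemma norm2_pvm_sum (A : (set R)^nat) n x :
  (forall k, measurable (A k)) -> trivIset setT A ->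
  `|\sum_(0 <= k < n) E (A k) x| ^+ 2 = \sum_(0 <= k < n) `|E (A k) x| ^+ 2.
Proof.
move=> mA tA; elim: n => [|n IHn]; first by rewrite !big_nil normr0 expr0n.
have En0 k : (k < n)%N -> inner (E (A k) x) (E (A n) x) = 0.
  move=> kn; have [_ _ ->] := pvm_proj E (mA k).
  rewrite -pvmI// (_ : A k `&` A n = set0) ?pvm0 ?inner0r//.
  by move/trivIsetP: tA; apply => //; rewrite ltn_eqF.
have S0 : inner (\sum_(0 <= k < n) E (A k) x) (E (A n) x) = 0.
  rewrite inner_suml big_nat big1// => k /andP[_ kn]; exact: En0.
by rewrite !big_nat_recr//= norm2D_ortho ?IHn.
Qed.

Lemma cvg_Re (u : R[i]^nat) (l : R[i]) :
  u @ \oo --> l -> (complex.Re (u n)) @[n --> \oo] --> complex.Re l.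
Proof.
move=> /cvgrPdist_lt ul; apply/cvgrPdist_lt => e e0.
have /ul : (0 < e%:C)%C by rewrite (ltcR 0 e).
apply: filterS => n; rewrite -(ltcR _ e); apply: le_lt_trans.
by rewrite (le_trans _ (normc_ge_Re _))// raddfB.
Qed.

Fact scalar_measure_sigma_additive x :
  semi_sigma_additive (scalar_measure x).
Proof.
move=> A mA tA mU; rewrite /scalar_measure.
under eq_fun do rewrite sumEFin.
apply: cvg_EFin; first exact: nearW.
rewrite [X in X @ _ --> _](_ : _ = fun n =>
  complex.Re (`|\sum_(0 <= k < n) E (A k) x| ^+ 2)); last first.
  apply/funext => n /=; rewrite norm2_pvm_sum//.
  elim: n => [|n IHn]; first by rewrite !big_nil.
  by rewrite !big_nat_recr//= IHn raddfD.
apply: cvg_Re; have /cvg_norm cE := @pvm_sigma_additive E A mA tA x.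
by under eq_fun do rewrite expr2; rewrite expr2; exact: cvgM.
Qed.

HB.instance Definition _ (x : H) := isMeasure.Build _ _ _ (scalar_measure x)
  (scalar_measure0 x) (scalar_measure_ge0 x) (@scalar_measure_sigma_additive x).

(* E is the spectral measure of the operator with graph G, i.e. G is the graph
   of the operator \int t dE(t). *)
Definition is_spectral_measure (G : set (H * H)) :=
  (forall x, graph_dom G x <->
     (\int[scalar_measure x]_t (t ^+ 2)%:E < +oo)%E) /\
  (forall x y, G (x, y) ->
     inner y x = (\int[scalar_measure x]_t t)%:C%C).

(* \int f d<E x, x> *)
Definition spectral_integral (f : R -> R[i]) (x : H) : R[i] :=
  Complex (\int[scalar_measure x]_t complex.Re (f t))
          (\int[scalar_measure x]_t complex.Im (f t)).

End spectral_measures.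
Arguments projection_valued_measure {R} H.

Section functional_calculus.
Context {R : realType} {H : hilbertSpace R}.

(* For f bounded Borel, the bounded operator F = \int f dE, E being the
   spectral measure of the closure of D, is determined by its quadratic form. *)
Definition is_functional_calculus (D : operator H) (f : R -> R[i])
    (F : H -> H) :=
  [/\ linear F, continuous F
    & exists2 E : projection_valued_measure H,
        is_spectral_measure E (closure_graph D)
      & forall x, inner (F x) x = spectral_integral E f x].

(* For D essentially self-adjoint and f bounded Borel, the spectral theorem
   gives exactly one F to choose from; the default value 0 is not used. *)
Definition functional_calculus (D : operator H) (f : R -> R[i]) : H -> H :=
  xget (fun=> 0) [set F | is_functional_calculus D f F].

End functional_calculus.

(* Main.v *)
Require Import Defs.
From HB Require Import structures.
From mathcomp Require Import all_boot all_order all_algebra.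
From mathcomp Require Import ring lra.
From mathcomp Require Import all_classical all_reals all_analysis.
From mathcomp Require Import measurable_realfun complex.

(* Let E be the spectral measure of the closure A of D, so that T maps the graph
   of A to itself up to the sign of the second component.  On the range of E(I),
   I = [c - r, c + r], the operator A - c has norm at most r, while A + c is
   bounded below by s > r on the range of E(L) when L is bounded and lies on one
   side of -c at distance at least s.  Since (A + c) E(L) T x = - E(L) T (A - c) x,
   iterating gives |E(L) T x| <= (r/s)^n |T| |x| for x in the range of E(I), so
   E(L) T E(I) = 0.  Countable unions of such I and L yield T E(B) = E(-B) T for
   half-lines B, hence for all Borel sets B.  Cutting the line into countably many
   pieces on which f oscillates by at most e, f(D) is close to a scalar on each
   spectral piece, and orthogonality of the pieces bounds T f(D) -/+ f(D) T by a
   multiple of e. *)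

Set Implicit Arguments.
Unset Strict Implicit.
Unset Printing Implicit Defensive.

Import Order.TTheory GRing.Theory Num.Theory.
Import numFieldNormedType.Exports.

Local Open Scope classical_set_scope.
Local Open Scope ring_scope.

(** * The real inner product of a complex Hilbert space, and bounds from quadratic forms *)

Section real_inner_product.
Context {R : realType} {H : hilbertSpace R}.
Implicit Types x y z : H.

(** Working over [R] turns every estimate into ordered-field arithmetic; imaginary parts are
    recovered by multiplying one argument by i. *)
Definition rdot x y : R := complex.Re (inner x y).

Definition norm2 x : R := rdot x x.

Lemma rdotDl x y z : rdot (x + y) z = rdot x z + rdot y z.
Proof. by rewrite /rdot innerDl raddfD. Qed.

Lemma rdotC x y : rdot x y = rdot y x.
Proof. by rewrite /rdot innerC; case: (inner y x). Qed.

Lemma rdotDr x y z : rdot x (y + z) = rdot x y + rdot x z.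
Proof. by rewrite rdotC rdotDl !(rdotC x). Qed.

Lemma rdot0l x : rdot 0 x = 0.
Proof. by rewrite /rdot inner0l. Qed.

Lemma rdotZl (r : R) x y : rdot (r%:C%C *: x) y = r * rdot x y.
Proof. by rewrite /rdot innerZl; case: inner => a b /=; rewrite mul0r subr0. Qed.

Lemma rdotZr (r : R) x y : rdot x (r%:C%C *: y) = r * rdot x y.
Proof. by rewrite rdotC rdotZl rdotC. Qed.

Lemma rdotNl x y : rdot (- x) y = - rdot x y.
Proof. by rewrite -scaleN1r -(rmorphN1 (real_complex R)) rdotZl mulN1r. Qed.

Lemma rdotNr x y : rdot x (- y) = - rdot x y.
Proof. by rewrite rdotC rdotNl rdotC. Qed.

Lemma rdot_iZl x y : rdot ('i%C *: x) y = - complex.Im (inner x y).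
Proof. by rewrite /rdot innerZl; case: inner => a b /=; rewrite mul0r mul1r sub0r. Qed.

Lemma rdot_iZr x y : rdot x ('i%C *: y) = - rdot ('i%C *: x) y.
Proof.
by rewrite rdotC !rdot_iZl innerC; case: (inner x y) => a b /=; rewrite !opprK.
Qed.

Lemma inner_norm2 x : inner x x = (norm2 x)%:C%C.
Proof.
rewrite /norm2 /rdot [LHS]complexE.
suff -> : complex.Im (inner x x) = 0 by rewrite mulr0 addr0.
have: 0 <= inner x x by rewrite inner_norm exprn_ge0.
by rewrite lecE => /andP[/eqP].
Qed.

Lemma norm2E x : (norm2 x)%:C%C = `|x| ^+ 2.
Proof. by rewrite -inner_norm2 inner_norm. Qed.

Lemma norm2_ge0 x : 0 <= norm2 x.
Proof. by rewrite -(lecR 0) norm2E exprn_ge0. Qed.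

Lemma norm2_le0 x : norm2 x <= 0 -> x = 0.
Proof.
move=> x0; have /eqP : norm2 x = 0 by apply/eqP; rewrite eq_le x0 norm2_ge0.
by rewrite -(inj_eq (@complexI _)) norm2E sqrf_eq0 normr_eq0 => /eqP.
Qed.

Lemma norm20 : norm2 (0 : H) = 0.
Proof. by rewrite /norm2 /rdot inner0l. Qed.

Lemma norm2N x : norm2 (- x) = norm2 x.
Proof. by rewrite /norm2 rdotNl rdotNr opprK. Qed.

(** Young's inequality: expand the squared norm of [x / s - y], which is nonnegative, and multiply
    by [s]. *)
Lemma rdot_le x y (s : R) : 0 < s -> 2 * rdot x y <= norm2 x / s + s * norm2 y.
Proof.
move=> s0; have := norm2_ge0 (s^-1%:C%C *: x - y).
rewrite /norm2 !(rdotDl, rdotDr, rdotNl, rdotNr, rdotZl, rdotZr) (rdotC y x).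
rewrite -(ler_pM2l s0) mulr0 => h.
rewrite -subr_ge0; apply: le_trans h _; rewrite le_eqVlt; apply/orP; left.
by apply/eqP; field; rewrite gt_eqF.
Qed.

Lemma norm2D_le x y : norm2 (x + y) <= 2 * norm2 x + 2 * norm2 y.
Proof.
have := @rdot_le x y 1 ltr01.
by rewrite /norm2 !(rdotDl, rdotDr) (rdotC y x); lra.
Qed.

Lemma cvg_norm2 (u : H^nat) x :
  u @ \oo --> x -> (norm2 (u n)) @[n --> \oo] --> norm2 x.
Proof.
move=> /cvg_norm ux.
have -> : norm2 x = complex.Re (`|x| ^+ 2) by rewrite -norm2E.
under eq_fun => n do rewrite -[norm2 _]/(complex.Re (norm2 (u n))%:C%C) norm2E.
apply: cvg_Re; under eq_fun do rewrite expr2; rewrite expr2; exact: cvgM.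
Qed.

(* Polarization over the real parts of [B x y] and ['i * B x y]. *)
Lemma form_bound (V : set H) (G : H -> H) (r : R) :
  linear G -> 0 < r ->
  (forall x y (a : R[i]), V x -> V y -> V (a *: x + y)) ->
  (forall x, V x -> V (G x)) ->
  (forall x, V x -> `|rdot (G x) x| <= r * norm2 x) ->
  (forall x, V x -> `|rdot ('i%C *: G x) x| <= r * norm2 x) ->
  forall x, V x -> norm2 (G x) <= 4 * r ^+ 2 * norm2 x.
Proof.
move=> Glin r0 VZ VG q1 q2 x Vx.
have GD a y z : G (a *: y + z) = a *: G y + G z by exact: Glin.
have polar y : V y -> rdot (G x) y <= r * (norm2 x + norm2 y).
  move=> Vy.
  have h1 := q1 _ (VZ _ _ 1 Vx Vy).
  have h2 := q1 _ (VZ _ _ (-1) Vx Vy).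
  have h3 := q2 _ (VZ _ _ 'i%C Vy Vx).
  have h4 := q2 _ (VZ _ _ (-'i%C) Vy Vx).
  have ii : ('i * 'i = -1 :> R[i])%C by rewrite -sqr_i expr2.
  move: h1 h2 h3 h4.
  rewrite !GD !scaleNr !scale1r !scalerDr !scalerN !scalerA !ii !scaleN1r /norm2.
  rewrite !(rdotDl, rdotDr, rdotNl, rdotNr, rdot_iZr, opprK, scalerA) !ii.
  rewrite !(scaleN1r, rdotNl, opprK).
  rewrite !ler_norml => /andP[? ?] /andP[? ?] /andP[? ?] /andP[? ?].
  lra.
have V0 : V 0 by have := VZ _ _ (-1) Vx Vx; rewrite scaleN1r addNr.
(* With y = G x / (2 r), [polar] reads N / (2 r) <= r |x|^2 + N / (4 r) for N = |G x|^2, whence N <=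
   4 r^2 |x|^2. *)
have := polar _ (VZ _ _ (2 * r)^-1%:C%C (VG _ Vx) V0).
rewrite /norm2 addr0 !(rdotZl, rdotZr) => h.
have -> : 4 * r ^+ 2 * rdot x x = (4 * r) * (r * rdot x x) by ring.
rewrite -ler_pdivrMl; last by lra.
move: h; rewrite mulrDr; set N := rdot (G x) (G x).
have -> : r * ((2 * r)^-1 * ((2 * r)^-1 * N)) = (4 * r)^-1 * N.
  by field; rewrite gt_eqF.
have -> : (2 * r)^-1 * N = 2 * ((4 * r)^-1 * N) by field; rewrite gt_eqF.
lra.
Qed.

End real_inner_product.

(** * Algebra and countable additivity of projection-valued measures *)

Section pvm_theory.
Context {R : realType} {H : hilbertSpace R}.
Variable E : projection_valued_measure H.
Implicit Types (A B : set R) (x y z : H).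

Lemma pvmP A (a : R[i]) x y : measurable A ->
  E A (a *: x + y) = a *: E A x + E A y.
Proof. by move=> /(pvm_proj E)[lE _ _]; exact: lE. Qed.

Lemma pvmD A x y : measurable A -> E A (x + y) = E A x + E A y.
Proof. by move=> mA; rewrite -[x in LHS]scale1r pvmP// scale1r. Qed.

Lemma pvm_vec0 A : measurable A -> E A 0 = 0.
Proof. by move=> mA; apply: (addIr (E A 0)); rewrite -pvmD// !add0r. Qed.

Lemma pvmZ A (a : R[i]) x : measurable A -> E A (a *: x) = a *: E A x.
Proof. by move=> mA; rewrite -[a *: x]addr0 pvmP// pvm_vec0// addr0. Qed.

Lemma pvmN A x : measurable A -> E A (- x) = - E A x.
Proof. by move=> mA; rewrite -scaleN1r pvmZ// scaleN1r. Qed.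

Lemma pvm_idem A x : measurable A -> E A (E A x) = E A x.
Proof. by move=> mA; rewrite -pvmI// setIid. Qed.

Lemma pvm_comm A B x : measurable A -> measurable B ->
  E A (E B x) = E B (E A x).
Proof. by move=> mA mB; rewrite -!pvmI// setIC. Qed.

Lemma pvm_sub A B x : measurable A -> measurable B -> A `<=` B ->
  E B (E A x) = E A x.
Proof. by move=> mA mB AB; rewrite -pvmI// setIC setIidl. Qed.

Lemma pvm_sub0 A B x : measurable A -> measurable B -> A `<=` B ->
  E B x = 0 -> E A x = 0.
Proof. by move=> mA mB /setIidl <- Bx; rewrite pvmI// Bx pvm_vec0. Qed.

Lemma pvm_disj A B x : measurable A -> measurable B -> A `&` B = set0 ->
  E A (E B x) = 0.
Proof. by move=> mA mB AB0; rewrite -pvmI// AB0 pvm0. Qed.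

Lemma rdot_pvm A x y : measurable A -> rdot (E A x) y = rdot x (E A y).
Proof. by move=> /(pvm_proj E)[_ _ sE]; rewrite /rdot sE. Qed.

Lemma pvm_setC A x : measurable A -> E A x + E (~` A) x = x.
Proof.
move=> mA; have mAC := measurableC mA.
(* Finite additivity comes from the sequence A, ~A, empty, empty, ..., whose partial sums are
   constant from index 2 on. *)
have mB : forall n, measurable (bigcup2 A (~` A) n) by case=> [|[|n]] //=.
have tB : trivIset setT (bigcup2 A (~` A)).
  by move=> [|[|i]] [|[|j]] // _ _ [t []] //=.
have := @pvm_sigma_additive _ _ E _ mB tB x.
rewrite bigcup2E setUv pvmT => Ex; rewrite -[RHS](cvg_lim _ Ex)//.
apply/esym/lim_near_cst => //.
exists 2%N => // -[|[|n]] //= _.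
rewrite !big_nat_recl//= big1 ?addr0// => i _; exact: pvm0.
Qed.

Lemma pvm_setC_eq0 A x : measurable A -> E (~` A) x = 0 -> E A x = x.
Proof. by move=> mA A0; rewrite -[RHS](pvm_setC x mA) A0 addr0. Qed.

Lemma pvm_setC0 A x : measurable A -> E A x = x -> E (~` A) x = 0.
Proof. by move=> mA {1}<-; rewrite pvm_disj ?setICl//; exact: measurableC. Qed.

Lemma norm2_pvm A x : measurable A ->
  norm2 (E A x) + norm2 (E (~` A) x) = norm2 x.
Proof.
move=> mA; rewrite -[in RHS](pvm_setC x mA) /norm2 rdotDl !rdotDr.
have mAC := measurableC mA.
have z : rdot (E A x) (E (~` A) x) = 0.
  by rewrite -rdot_pvm// pvm_disj ?rdot0l// setICl.
by rewrite (rdotC (E (~` A) x)) z addr0 add0r.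
Qed.

Lemma norm2_pvm_le A x : measurable A -> norm2 (E A x) <= norm2 x.
Proof. by move=> mA; rewrite -(norm2_pvm x mA) lerDl norm2_ge0. Qed.

Lemma scalar_measureE x A : scalar_measure E x A = (norm2 (E A x))%:E.
Proof. by rewrite /scalar_measure -norm2E. Qed.

Lemma pvm_bigcup_cvg (A : (set R)^nat) x :
  (forall k, measurable (A k)) ->
  (fun n => \sum_(0 <= k < n) E (seqDU A k) x) @ \oo --> E (\bigcup_k A k) x.
Proof.
move=> mA; rewrite seqDU_bigcup_eq; apply: pvm_sigma_additive => //.
by move=> k; apply: measurableD => //; exact: bigsetU_measurable.
Qed.

(** The partial sums [u n] converge to z = E(union) x, and [E B] kills each [T (u n)]. As [E B] is a
    contraction, |E B (T z)| <= |T z - T (u n)|, which tends to 0. *)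
Lemma pvm_bigcup_range (T : {linear H -> H}) B (A : (set R)^nat) :
  continuous T -> measurable B -> (forall k, measurable (A k)) ->
  (forall k x, E B (T (E (A k) x)) = 0) ->
  forall x, E B (T (E (\bigcup_k A k) x)) = 0.
Proof.
move=> cT mB mA TA0 x; set z := E _ x.
pose u n := \sum_(0 <= k < n) E (seqDU A k) x.
have u0 n : E B (T (u n)) = 0.
  rewrite /u; elim/big_ind : _ => [|v w v0 w0|k _].
  - by rewrite linear0 pvm_vec0.
  - by rewrite linearD pvmD// v0 w0 addr0.
  have mD : measurable (seqDU A k).
    by apply: measurableD => //; exact: bigsetU_measurable.
  have <- : E (A k) (E (seqDU A k) x) = E (seqDU A k) x.
    by apply: pvm_sub => //; exact: subDsetl.
  exact: TA0.
have uz : T z - T (u n) @[n --> \oo] --> T z - T z.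
  by apply: cvgB; [exact: cvg_cst|exact: (cvg_comp _ _ (pvm_bigcup_cvg (x:=x) mA) (cT z))].
apply: norm2_le0; have nz := cvg_norm2 uz.
rewrite -(norm20 (H:=H)) -(subrr (T z)) -(cvg_lim _ nz)//.
apply: limr_ge; [exact: cvgP nz|apply: nearW => n].
rewrite -[E B (T z)]subr0 -(u0 n) -pvmN// -pvmD//; exact: norm2_pvm_le.
Qed.

Lemma pvm_bigcup0 (A : (set R)^nat) x :
  (forall k, measurable (A k)) ->
  (forall k, E (A k) x = 0) -> E (\bigcup_k A k) x = 0.
Proof.
move=> mA A0; rewrite -[LHS](cvg_lim _ (pvm_bigcup_cvg (x:=x) mA))//.
apply: lim_near_cst => //; apply: nearW => n /=; rewrite big1// => k _.
have mD : measurable (seqDU A k).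
  by apply: measurableD => //; exact: bigsetU_measurable.
have <- : E (A k) (E (seqDU A k) x) = E (seqDU A k) x.
  by apply: pvm_sub => //; exact: subDsetl.
by rewrite pvm_comm// A0 pvm_vec0.
Qed.

End pvm_theory.

(** * Integration against the scalar measures of vectors in a spectral subspace *)

Section pvm_integration.
Context {R : realType} {H : hilbertSpace R}.
Variable E : projection_valued_measure H.
Implicit Types (A B : set R) (x y z : H) (g : R -> R).

Lemma pvm_ortho B x z : measurable B -> E B x = x -> E (~` B) z = z ->
  rdot x z = 0.
Proof.
move=> mB <- <-; rewrite rdot_pvm// pvm_disj ?setICr//; last exact: measurableC.
by rewrite rdotC rdot0l.
Qed.

(** The complement of [B] is null for the scalar measure of [x], and this measure is finite. *)
Lemma pvm_integrable B x g (M : R) : measurable B -> E B x = x ->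
  measurable_fun setT g -> (forall t, B t -> `|g t| <= M) ->
  (scalar_measure E x).-integrable setT (EFin \o g).
Proof.
move=> mB Bx mg gM; have mBC := measurableC mB.
apply/(negligible_integrable mBC) => //.
- exact/measurable_EFinP.
- by rewrite /= scalar_measureE pvm_setC0// norm20.
rewrite setTD setCK; apply: measurable_bounded_integrable => //.
- by rewrite /= scalar_measureE ltry.
- exact: measurable_funTS.
exists M; split=> [|y My t Bt]; first exact: num_real.
exact: le_trans (gM t Bt) (ltW My).
Qed.

Lemma pvm_integral_bounds B x g (m M : R) : measurable B -> E B x = x ->
  measurable_fun setT g -> (forall t, B t -> m <= g t <= M) ->
  m * norm2 x <= \int[scalar_measure E x]_t g t <= M * norm2 x.
Proof.
move=> mB Bx mg gmM; have mBC := measurableC mB.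
have ig : (scalar_measure E x).-integrable setT (EFin \o g).
  apply: (@pvm_integrable B x g (`|m| + `|M|)) => // t /gmM /andP[mt tM].
  rewrite ler_norml; have := ler_norm M; have := ler_norm (- m).
  by rewrite normrN; have := normr_ge0 m; have := normr_ge0 M; lra.
have -> : \int[scalar_measure E x]_t g t = \int[scalar_measure E x]_(t in B) g t.
  rewrite /Rintegral [in LHS](negligible_integral mBC)//= ?setTD ?setCK//.
  by rewrite scalar_measureE pvm_setC0// norm20.
have cint (c : R) : \int[scalar_measure E x]_(t in B) c = c * norm2 x.
  rewrite Rintegral_cst//; congr (_ * _).
  by rewrite (_ : norm2 x = fine (scalar_measure E x B))// scalar_measureE Bx.
have ic (c : R) : (scalar_measure E x).-integrable B (EFin \o cst c).
  apply: measurable_bounded_integrable => //; first by rewrite /= scalar_measureE ltry.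
  exact: bounded_cst.
have igB : (scalar_measure E x).-integrable B (EFin \o g).
  exact: integrableS ig.
by rewrite -!cint; apply/andP; split; apply: le_Rintegral => //;
  do ?[exact: ic | by move=> t /gmM/andP[]].
Qed.

(** The vectors [E A x] and [E A z] are orthogonal for every Borel [A], so by Pythagoras the scalar
    measure of [x + z] is the sum of those of [x] and [z]. *)
Lemma pvm_integralD B x z g : measurable B -> E B x = x -> E (~` B) z = z ->
  (scalar_measure E x).-integrable setT (EFin \o g) ->
  (scalar_measure E z).-integrable setT (EFin \o g) ->
  \int[scalar_measure E (x + z)]_t g t =
  \int[scalar_measure E x]_t g t + \int[scalar_measure E z]_t g t.
Proof.
move=> mB Bx Bz ix iz; have mBC := measurableC mB.
rewrite /Rintegral -fineD ?integrable_fin_num//; congr fine.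
rewrite -integral_measure_add//.
apply: eq_measure_integral => A mA _.
rewrite -[RHS]/(measure_add (scalar_measure E x) (scalar_measure E z) A).
rewrite measure_addE /= !scalar_measureE -EFinD pvmD//; congr EFin.
have o : rdot (E A x) (E A z) = 0.
  by apply: (@pvm_ortho B) => //; rewrite pvm_comm// ?Bx ?Bz.
by rewrite /norm2 rdotDl !rdotDr (rdotC (E A z)) o addr0 add0r.
Qed.

End pvm_integration.

(** * The closure of the graph: linearity and anticommutation with T *)

Lemma closure_preimage (U V : topologicalType) (f : U -> V) (A : set U)
    (C : set V) :
  continuous f -> closed C -> (forall p, A p -> C (f p)) ->
  forall p, closure A p -> C (f p).
Proof.
move=> cf cC AC; suff : closure A `<=` f @^-1` C by [].
have /closure_id -> : closed (f @^-1` C) by apply: preimage_closed => // x _; exact: cf.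
exact: closureS.
Qed.

Section closure_graph_theory.
Context {R : realType} {H : hilbertSpace R}.
Variable D : operator H.

Lemma closure_graphP (a : R[i]) (x y z w : H) :
  closure_graph D (x, y) -> closure_graph D (z, w) ->
  closure_graph D (a *: x + z, a *: y + w).
Proof.
have clD : closed (closure_graph D) by exact: closed_closure.
(* The closure is taken in one argument of [h] at a time, the other being frozen. *)
pose h (p q : H * H) : H * H := (a *: p.1 + q.1, a *: p.2 + q.2).
have ch1 p : continuous (h p).
  move=> q; apply: cvg_pair => /=.
    by apply: cvgD; [exact: cvg_cst|exact: cvg_fst].
  by apply: cvgD; [exact: cvg_cst|exact: cvg_snd].
have ch2 q : continuous (h ^~ q).
  move=> p; apply: cvg_pair => /=.
    by apply: cvgD; [apply: cvgZr; exact: cvg_fst|exact: cvg_cst].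
  by apply: cvgD; [apply: cvgZr; exact: cvg_snd|exact: cvg_cst].
move=> xy zw; rewrite -[X in closure_graph D X]/(h (x, y) (z, w)).
move: (z, w) zw => q Gq; rewrite -[X in closure_graph D X]/((h ^~ q) (x, y)).
move: xy; apply: (closure_preimage (ch2 q) clD) => p Dp.
rewrite -[X in closure_graph D X]/(h p q).
move: Gq; apply: (closure_preimage (ch1 p) clD) => {}q Dq.
apply: subset_closure; move: p q Dp Dq => [p1 p2] [q1 q2] /= [Dp /= <-] [Dq /= <-].
by split => /=; [exact: domP|rewrite opfunP].
Qed.

Lemma closure_graph_anticomm (T : {linear H -> H}) :
  continuous T -> (forall x, dom D x -> dom D (T x)) ->
  (forall x, dom D x -> T (D x) = - D (T x)) ->
  forall x y, closure_graph D (x, y) -> closure_graph D (T x, - T y).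
Proof.
move=> cT TD TDN x y.
pose h (p : H * H) : H * H := (T p.1, - T p.2).
have ch : continuous h.
  move=> p; apply: cvg_pair => /=.
    by apply: cvg_comp; [exact: cvg_fst|exact: cT].
  by apply: cvgN; apply: cvg_comp; [exact: cvg_snd|exact: cT].
apply: (closure_preimage ch (@closed_closure _ _)) => -[{}x {}y] /= [Dx /= <-].
apply: subset_closure; split => /=; first exact: TD.
by rewrite TDN// opprK.
Qed.

End closure_graph_theory.

(** * Operator bounds, geometric decay and truncation to bounded sets *)

Lemma continuous_norm2_bound (R : realType) (H : hilbertSpace R)
    (T : {linear H -> H}) :
  continuous T ->
  exists2 K : R, 0 <= K & forall x, norm2 (T x) <= K * norm2 x.
Proof.
move=> cT; have /linear_boundedP/pinfty_ex_gt0[M M0 TM] :=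
  continuous_linear_bounded 0 (cT 0).
exists (complex.Re M ^+ 2); first exact: sqr_ge0.
have MR : M = (complex.Re M)%:C%C by rewrite RRe_real// gtr0_real.
move=> x; rewrite -lecR rmorphM rmorphXn /= -MR !norm2E -exprMn.
by rewrite lerXn2r ?nnegrE // mulr_ge0// ltW.
Qed.

Lemma le_geometric_le0 (R : realType) (a k q : R) : 0 <= q < 1 ->
  (forall n, a <= k * q ^+ n) -> a <= 0.
Proof.
move=> /andP[q0 q1] ak.
have /cvg_geometric kq : `|q| < 1 by rewrite ger0_norm.
have kq0 := kq k; rewrite -(cvg_lim _ kq0)//.
by apply: limr_ge; [exact: cvgP kq0|exact: nearW].
Qed.

Lemma measurable_normr_le (R : realType) (M : R) :
  measurable [set t : R | `|t| <= M].
Proof.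
rewrite (_ : [set _ | _] = `[(- M), M]%classic); first exact: measurable_itv.
by apply/seteqP; split=> t /=; rewrite in_itv /= ler_norml.
Qed.

Lemma setI_normr_bigcup (R : realType) (B : set R) :
  B = \bigcup_n (B `&` [set t | `|t| <= n%:R]).
Proof.
rewrite -setI_bigcupr -[LHS]setIT; congr (_ `&` _); apply/esym.
rewrite -subTset => t _; exists (Num.truncn `|t|).+1 => //=.
by rewrite ltW// truncnS_gt.
Qed.

(** * The unbounded operator on spectral subspaces, and the spectral gap estimate *)

Section spectral_subspaces.
Context {R : realType} {H : hilbertSpace R}.
Variables (E : projection_valued_measure H) (G : set (H * H)).
Hypothesis GE : is_spectral_measure E G.
Hypothesis GP : forall (a : R[i]) x y z w,
  G (x, y) -> G (z, w) -> G (a *: x + z, a *: y + w).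
Implicit Types (B : set R) (x y z w : H).

Lemma spectral_form x y : G (x, y) -> rdot y x = \int[scalar_measure E x]_t t.
Proof. by move=> Gxy; rewrite /rdot (GE.2 _ _ Gxy). Qed.

(* The form of the operator is real, hence the operator is symmetric. *)
Lemma spectral_symmetric x y z w : G (x, y) -> G (z, w) -> rdot y z = rdot w x.
Proof.
have real0 u v : G (u, v) -> rdot ('i%C *: v) u = 0.
  by move=> Guv; rewrite rdot_iZl (GE.2 _ _ Guv) oppr0.
move=> Gxy Gzw; have := real0 _ _ (GP 'i%C Gzw Gxy).
rewrite scalerDr scalerA -expr2 sqr_i scaleN1r.
rewrite !(rdotDl, rdotDr, rdotNl, rdotNr, rdot_iZr, opprK).
rewrite (real0 _ _ Gxy) (real0 _ _ Gzw).
have -> : rdot ('i%C *: ('i%C *: y)) z = - rdot y z.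
  by rewrite scalerA -expr2 sqr_i scaleN1r rdotNl.
lra.
Qed.

(** The scalar measure of [x] lives on the bounded set [B], so its second moment is finite. *)
Lemma spectral_dom B x (M : R) : measurable B ->
  (forall t, B t -> `|t| <= M) -> E B x = x -> exists y, G (x, y).
Proof.
move=> mB BM Bx; apply/(GE.1 x).
have /integrableP[_] : (scalar_measure E x).-integrable setT
    (EFin \o fun t : R => t ^+ 2).
  apply: (@pvm_integrable _ _ E B x _ (M ^+ 2)) => //.
  move=> t /BM tM; rewrite normrX lerXn2r ?nnegrE//.
  exact: le_trans (normr_ge0 t) tM.
under eq_integral do rewrite /= ger0_norm ?sqr_ge0//.
by [].
Qed.

Lemma spectral_integrable x y : G (x, y) ->
  (scalar_measure E x).-integrable setT (EFin \o (@id R)).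
Proof.
move=> Gxy; have mX : measurable_fun setT (fun t : R => t ^+ 2) by [].
have isq : (scalar_measure E x).-integrable setT (EFin \o fun t : R => t ^+ 2).
  apply/integrableP; split; first exact/measurable_EFinP.
  under eq_integral do rewrite /= ger0_norm ?sqr_ge0//.
  by apply/(GE.1 x); exists y.
have i1 : (scalar_measure E x).-integrable setT (EFin \o @cst R R 1).
  apply: (@pvm_integrable _ _ E setT x _ 1) => //; first by rewrite pvmT.
  by move=> t _; rewrite /= normr1.
apply: (le_integrable measurableT _ _ (integrableD measurableT i1 isq)).
  exact/measurable_EFinP.
move=> t _ /=.
 rewrite lee_fin [leRHS]ger0_norm ?addr_ge0 ?sqr_ge0//.
rewrite ler_norml; have := sqr_ge0 (t - 1); have := sqr_ge0 (t + 1).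
have := sqr_ge0 t; rewrite sqrrB1 sqrrD1; lra.
Qed.

(** Truncation puts z = E(C n) y in the domain, in the range of E(~B). The form is additive on x +
    z, so its cross terms, equal by symmetry, vanish: 0 = <y, z> = |z|^2 in real part. Letting n
    vary gives E(~B) y = 0. *)
Lemma spectral_range B x y : measurable B -> G (x, y) -> E B x = x -> E B y = y.
Proof.
move=> mB Gxy Bx; apply: pvm_setC_eq0 => //; have mBC := measurableC mB.
pose C n := ~` B `&` [set t : R | `|t| <= n%:R].
have mC n : measurable (C n).
  by apply: measurableI => //; exact: measurable_normr_le.
have -> : ~` B = \bigcup_n C n by exact: setI_normr_bigcup.
apply: pvm_bigcup0 => // n; apply: norm2_le0.
pose z := E (C n) y.
have Cz : E (C n) z = z by exact: pvm_idem.
have Bz : E (~` B) z = z by rewrite -{1}Cz pvm_sub//; exact: subIsetl.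
have [w Gzw] : exists w, G (z, w).
  by apply: (@spectral_dom (C n) z n%:R) => // t [].
have := spectral_form (GP 1 Gxy Gzw); rewrite !scale1r.
rewrite (pvm_integralD mB) //; do ?exact: spectral_integrable Gxy;
  do ?exact: spectral_integrable Gzw.
rewrite -(spectral_form Gxy) -(spectral_form Gzw) !(rdotDl, rdotDr).
rewrite (spectral_symmetric Gxy Gzw) => h.
have : rdot y z = 0 by rewrite (spectral_symmetric Gxy Gzw); lra.
by rewrite /norm2 rdot_pvm// -/z Cz => ->.
Qed.

(** The constant is sharp, as the ratio r / s < 1 of the gap argument demands. With u = y - c x,
    compare the upper bound of the form at u / r + x with the lower bound at - u / r + x: the
    unknown term <w, u> cancels, leaving |u|^2 / r <= r |x|^2. *)
Lemma spectral_bound B x y (c r : R) : measurable B -> 0 < r ->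
  (forall t, B t -> c - r <= t <= c + r) -> E B x = x -> G (x, y) ->
  norm2 (y - c%:C%C *: x) <= r ^+ 2 * norm2 x.
Proof.
move=> mB r0 Br Bx Gxy; have By := spectral_range mB Gxy Bx.
set u := y - _; have yE : y = u + c%:C%C *: x by rewrite subrK.
have Bu : E B u = u by rewrite /u addrC -scaleNr pvmP// Bx By.
move: u yE Bu => u yE Bu.
have BM t : B t -> `|t| <= `|c| + r.
  move=> /Br; rewrite ler_norml; have := ler_norm c; have := ler_norm (- c).
  rewrite normrN; lra.
have [w Guw] := spectral_dom mB BM Bu.
have form v v' : E B v = v -> G (v, v') ->
    (c - r) * norm2 v <= rdot v' v <= (c + r) * norm2 v.
  by move=> Bv Gv; rewrite (spectral_form Gv); apply: (pvm_integral_bounds mB).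
have lin (a : R[i]) : E B (a *: u + x) = a *: u + x by rewrite pvmP// Bu Bx.
have /andP[_] := form _ _ (lin r^-1%:C%C) (GP _ Guw Gxy).
have /andP[+ _] := form _ _ (lin (- r^-1)%:C%C) (GP _ Guw Gxy).
rewrite /norm2 !(rdotDl, rdotDr, rdotZl, rdotZr).
rewrite (spectral_symmetric Guw Gxy) (rdotC x u) !(congr1 (rdot^~ _) yE).
rewrite !(rdotDl, rdotZl) (rdotC x u).
set N := rdot u u; set n := rdot x x; set p := rdot u x.
have rN : r * (r^-1 * (r^-1 * N)) = r^-1 * N by rewrite mulVKf ?gt_eqF.
have rp : r * (r^-1 * p) = p by rewrite mulVKf ?gt_eqF.
by move=> h1 h2; rewrite expr2 -mulrA -ler_pdivrMl//; lra.
Qed.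

(** [b] tells on which side of -c the set [A] lies: right for [false], left for [true]. The bound
    [M] keeps the range of [E A] inside the domain. *)
Lemma spectral_gap (T : {linear H -> H}) (B A : set R) (c r s M : R) (b : bool) :
  continuous T -> (forall x y, G (x, y) -> G (T x, - T y)) ->
  measurable B -> measurable A -> 0 < r -> r < s ->
  (forall t, B t -> c - r <= t <= c + r) ->
  (forall t, A t -> s <= (-1) ^+ b * (t + c)) -> (forall t, A t -> `|t| <= M) ->
  forall x, E A (T (E B x)) = 0.
Proof.
move=> cT GT mB mA r0 rs Br As AM; have mAC := measurableC mA.
have s0 : 0 < s by exact: lt_trans rs.
have [K K0 TK] := continuous_norm2_bound cT.
suff step n x : E B x = x ->
    (s ^+ 2) ^+ n * norm2 (E A (T x)) <= K * (r ^+ 2) ^+ n * norm2 x.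
  move=> x; apply: norm2_le0; have Bx := pvm_idem E x mB.
  apply: (@le_geometric_le0 _ _ (K * norm2 (E B x)) (r ^+ 2 / s ^+ 2)).
    rewrite divr_ge0 ?sqr_ge0//= ltr_pdivrMr ?exprn_gt0// mul1r.
    by rewrite ltrXn2r// ?nnegrE ltW.
  move=> n; rewrite expr_div_n mulrA ler_pdivlMr ?exprn_gt0//.
  by rewrite mulrAC [leLHS]mulrC; exact: step.
elim: n x => [|n IHn] x Bx.
  rewrite !expr0 mulr1 mul1r; apply: le_trans (TK x); exact: norm2_pvm_le.
have BM t : B t -> `|t| <= `|c| + r.
  move=> /Br; rewrite ler_norml; have := ler_norm c; have := ler_norm (- c).
  rewrite normrN; lra.
have [y Gxy] := spectral_dom mB BM Bx.
have By := spectral_range mB Gxy Bx.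
have Bu : E B (y - c%:C%C *: x) = y - c%:C%C *: x.
  by rewrite addrC -scaleNr pvmP// Bx By.
have le1 := spectral_bound mB r0 Br Bx Gxy.
(* The induction passes from x to y - c x, which stays in the range of [E B] and costs a factor
   r. *)
have {IHn Bu} IH := IHn _ Bu.
have [u uE] : exists u, u = y - c%:C%C *: x by eexists.
rewrite -uE in le1 IH.
have Au : E A (E A (T x)) = E A (T x) by exact: pvm_idem.
have [v Gv] := spectral_dom mA AM Au.
have Av := spectral_range mA Gv Au.
(* The vector T x - E A (T x) lies in the range of E(~A), hence so does its image - T y - v;
   applying [E A] gives the formula. *)
have vE : v = - E A (T y).
  have := GP (-1) Gv (GT _ _ Gxy); rewrite !scaleN1r => GC.
  have ACx : E (~` A) (- E A (T x) + T x) = - E A (T x) + T x.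
    by rewrite -{2 4}(pvm_setC E (T x) mA) addKr pvm_idem.
  have := pvm_setC0 mAC (spectral_range mAC GC ACx).
  rewrite setCK pvmD// !pvmN// Av => /eqP; rewrite addrC subr_eq0 => /eqP <-.
  by [].
have le2 : s ^+ 2 * norm2 (E A (T x)) <= norm2 (E A (T u)).
  have vu : v + c%:C%C *: E A (T x) = - E A (T u).
    by rewrite uE linearB linearZ pvmD// pvmN// pvmZ// opprD opprK vE.
  have AE t : A t -> - M <= t <= M by move=> /AM; rewrite ler_norml.
  (* [rdot_le] with weight s upgrades this form bound to the norm bound; both signs are needed
     because of the absolute value. *)
  suff le3 : s * norm2 (E A (T x)) <= `|rdot (E A (T u)) (E A (T x))|.
    have := @rdot_le _ _ (E A (T u)) (E A (T x)) s s0.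
    have := @rdot_le _ _ (- E A (T u)) (E A (T x)) s s0.
    rewrite norm2N rdotNl => d1 d2; rewrite expr2 -mulrA -ler_pdivlMl// mulrC.
    by move: le3; rewrite ler_normr => /orP[]; lra.
  have form : rdot v (E A (T x)) = - rdot (E A (T u)) (E A (T x)) -
      c * norm2 (E A (T x)).
    by rewrite -rdotNl -vu rdotDl rdotZl addrK.
  move: (spectral_form Gv); rewrite form => {}form.
  (* Only the bound -s - c (resp. s - c) matters; -M and M fill in the other side of the two-sided
     integral estimate. *)
  case: b As => As; rewrite ler_normr; apply/orP.
    left; have := @pvm_integral_bounds _ _ E A _ id (- M) (- s - c) mA Au.
    rewrite -form => /(_ _ _)/andP[|t At|] //; last lra.
    by have := As _ At; have /andP[] := AE _ At; rewrite expr1; lra.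
  right; have := @pvm_integral_bounds _ _ E A _ id (s - c) M mA Au.
  rewrite -form => /(_ _ _)/andP[|t At|] //; last lra.
  by have := As _ At; have /andP[] := AE _ At; rewrite expr0; lra.
rewrite (exprSr (s ^+ 2)) -mulrA; apply: (le_trans (ler_wpM2l _ le2)).
  by rewrite !exprn_ge0// ltW.
apply: (le_trans IH); rewrite (exprSr (r ^+ 2)) -!mulrA.
apply: ler_wpM2l => //; apply: ler_wpM2l; first by rewrite exprn_ge0 ?sqr_ge0.
by rewrite mulrA -expr2.
Qed.

End spectral_subspaces.

(** * Reflection of the spectral measure by T *)

Lemma measurable_opp_preimage (R : realType) (B : set R) :
  measurable B -> measurable (-%R @^-1` B).
Proof. by move=> mB; rewrite -[X in measurable X]setTI; exact: oppr_measurable. Qed.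

(** Exhausts an open ray by closed rays at a positive distance from its endpoint, as [half_line_gap]
    requires. *)
Lemma lt_bigcup (R : realType) : exists2 d : R^nat, (forall k, 0 < d k) &
  forall a, [set t | t < a] = \bigcup_k [set t | t <= a - d k].
Proof.
exists (fun k => k.+1%:R^-1) => // a.
apply/seteqP; split => [t /= ta|t [k _ /= tk]]; last first.
  by apply: (le_lt_trans tk); rewrite ltrBlDr ltrDl.
have [k tk] := ltr_add_invr ta.
by exists k => //=; rewrite lerBrDr ltW.
Qed.

Section spectral_reflection.
Context {R : realType} {H : hilbertSpace R}.
Variables (E : projection_valued_measure H) (G : set (H * H)).
Hypothesis GE : is_spectral_measure E G.
Hypothesis GP : forall (a : R[i]) x y z w,
  G (x, y) -> G (z, w) -> G (a *: x + z, a *: y + w).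
Variable T : {linear H -> H}.
Hypothesis cT : continuous T.
Hypothesis GT : forall x y, G (x, y) -> G (T x, - T y).
Implicit Types (A B : set R) (x : H).

Lemma pvm_bigcup_left (A : (set R)^nat) B :
  (forall k, measurable (A k)) ->
  (forall k x, E (A k) (T (E B x)) = 0) ->
  forall x, E (\bigcup_k A k) (T (E B x)) = 0.
Proof. by move=> mA A0 x; apply: pvm_bigcup0 => // k; exact: A0. Qed.

Lemma half_line_gap A B (b : bool) (q d : R) :
  measurable A -> measurable B -> 0 < d ->
  (forall t, B t -> (-1) ^+ b * t <= q) ->
  (forall t, A t -> (-1) ^+ b * t <= - q - d) ->
  forall x, E A (T (E B x)) = 0.
Proof.
move=> mA mB d0 Bq Aq; rewrite (setI_normr_bigcup A) (setI_normr_bigcup B).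
have mI C n : measurable C -> measurable (C `&` [set t : R | `|t| <= n%:R]).
  by move=> mC; apply: measurableI => //; exact: measurable_normr_le.
apply: pvm_bigcup_range => // [|k|k].
  by apply: bigcupT_measurable => n; exact: mI.
  exact: mI.
apply: pvm_bigcup_left => [n|n]; first exact: mI.
(* The interval of radius r is placed so that its end on the side of the gap is (-1)^b q and it
   covers B within [-k, k]. The distance from -c to A is then at least r + d, however large r is. *)
pose r := `|q| + k%:R + 1.
have r0 : 0 < r by rewrite ltr_wpDl// addr_ge0.
have hr : r = `|q| + k%:R + 1 by [].
have := ler_norm q; have := ler_norm (- q); rewrite normrN => q1 q2.
clearbody r.
apply: (@spectral_gap _ _ E G GE GP T _ _ ((-1) ^+ b * (q - r)) r (r + d) n%:R
  (~~ b)) => //; do ?exact: mI; rewrite ?ltrDl//.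
- move=> t [/Bq + /=]; rewrite ler_norml => + /andP[].
  by case: b {Bq Aq}; rewrite ?expr1 ?expr0; lra.
- move=> t [/Aq + _]; case: b {Bq Aq} => /=; rewrite ?expr1 ?expr0; lra.
by move=> t [].
Qed.

(* T E(B) = E(-B) T, in a form visibly stable under complements and countable
   unions. *)
Definition reflects B := forall x,
  E (~` (-%R @^-1` B)) (T (E B x)) = 0 /\ E (-%R @^-1` B) (T (E (~` B) x)) = 0.

(** In each clause the half-lines B and -A have a as common endpoint, leaving no gap; replacing the
    open one by the closed rays of [lt_bigcup] opens a gap [d k]. *)
Lemma reflects_ray (a : R) : reflects [set t | t < a].
Proof.
have mlt : measurable [set t : R | t < a] by rewrite -set_itvNyo.
have mN := measurable_opp_preimage mlt.
have mle (c : R) : measurable [set t : R | t <= c] by rewrite -set_itvNyc.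
have mge (c : R) : measurable [set t : R | c <= t] by rewrite -set_itvcy.
have [d d0 ltE] := lt_bigcup R.
move=> x; split.
  move: x; rewrite {2}ltE; apply: pvm_bigcup_range => // [|k].
    exact: measurableC.
  apply: (@half_line_gap _ _ false (a - d k) (d k)) => //.
  - exact: measurableC.
  - by move=> t /=; rewrite mul1r.
  - by move=> t /= /negP; rewrite -leNgt mul1r; lra.
move: x; have -> : -%R @^-1` [set t | t < a] =
    \bigcup_k [set t : R | - a + d k <= t].
  rewrite ltE preimage_bigcup; apply: eq_bigcupr => k _.
  by apply/seteqP; split => t /=; lra.
apply: pvm_bigcup_left => // k.
apply: (@half_line_gap _ _ true (- a) (d k)) => //.
- exact: measurableC.
- by move=> t /= /negP; rewrite -leNgt expr1; lra.
- by move=> t /=; rewrite expr1; lra.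
Qed.

(** Open rays generate the Borel sets, and reflecting sets form a sigma-algebra: complementation
    swaps the two clauses, and unions pass through the range of E in the first and through its
    kernel in the second. *)
Lemma reflects_measurable B : measurable B -> reflects B.
Proof.
move=> mB; suff : (measurable : set (set R)) `<=` [set C | measurable C /\ reflects C].
  by move=> /(_ _ mB)[].
rewrite [X in X `<=` _]RGenInftyO.measurableE; apply: smallest_sub; last first.
  move=> _ [a ->]; split; first exact: measurable_itv.
  by rewrite set_itvNyo; exact: reflects_ray.
split.
- split => // x; rewrite preimage_set0 pvm0 linear0 pvm_vec0 ?pvm0//.
  exact: measurableC.
- move=> C [mC rC]; split => [|x]; first by rewrite setTD; exact: measurableC.
  by rewrite !setTD preimage_setC !setCK; have [] := rC x.
move=> C CP; have mC k : measurable (C k) by have [] := CP k.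
have rC k : reflects (C k) by have [] := CP k.
have mU := bigcupT_measurable C mC; have mUC := measurableC mU.
split=> // x; have mN k := measurable_opp_preimage (mC k).
have mNU : measurable (-%R @^-1` \bigcup_k C k) by exact: measurable_opp_preimage.
split.
  apply: pvm_bigcup_range => //; first exact: measurableC.
  move=> k {}x; have mNC := measurableC (mN k).
  apply: (@pvm_sub0 _ _ _ _ (~` (-%R @^-1` C k))); [exact: measurableC|by []| |].
    by apply: subsetC => t Ct; exists k.
  by have [] := rC k x.
rewrite preimage_bigcup; apply: pvm_bigcup0 => // k.
have <- : E (~` C k) (E (~` \bigcup_k C k) x) = E (~` \bigcup_k C k) x.
  apply: pvm_sub => //; first exact: measurableC.
  by apply: subsetC => t Ct; exists k.
by have [_] := rC k (E (~` \bigcup_k C k) x).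
Qed.

(** Both off-diagonal blocks of T, from B to the complement of -B and from ~B to -B, vanish. *)
Lemma reflects_comm B x : measurable B ->
  T (E B x) = E (-%R @^-1` B) (T x).
Proof.
move=> mB; have mN := measurable_opp_preimage mB.
have [r1 r2] := reflects_measurable mB x.
rewrite -[in RHS](pvm_setC E x mB) linearD pvmD// r2 addr0.
by rewrite -[LHS](pvm_setC E _ mN) r1 addr0.
Qed.

End spectral_reflection.

(** * Locality of an operator given by a spectral quadratic form *)

Section functional_calculus_form.
Context {R : realType} {H : hilbertSpace R}.
Variables (E : projection_valued_measure H) (f : R -> R[i]) (F : H -> H).
Hypothesis mRe : measurable_fun setT (fun t => complex.Re (f t)).
Hypothesis mIm : measurable_fun setT (fun t => complex.Im (f t)).
Variable M : R.
Hypothesis ReM : forall t, `|complex.Re (f t)| <= M.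
Hypothesis ImM : forall t, `|complex.Im (f t)| <= M.
Hypothesis linF : linear F.
Hypothesis formF : forall x, inner (F x) x = spectral_integral E f x.
Implicit Types (B : set R) (x y z : H).

Lemma fc_formRe x :
  rdot (F x) x = \int[scalar_measure E x]_t complex.Re (f t).
Proof. by rewrite /rdot formF. Qed.

Lemma fc_formIm x :
  rdot ('i%C *: F x) x = - \int[scalar_measure E x]_t complex.Im (f t).
Proof. by rewrite rdot_iZl formF. Qed.

Lemma fcD x y : F (x + y) = F x + F y.
Proof. by have := linF 1 x y; rewrite !scale1r. Qed.

Lemma fc0 : F 0 = 0.
Proof. by apply: (addIr (F 0)); rewrite -fcD !add0r. Qed.

Lemma fcZ (a : R[i]) x : F (a *: x) = a *: F x.
Proof. by rewrite -[a *: x]addr0 linF fc0 addr0. Qed.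

(** Additivity of the form makes cross terms vanish: the real form at x + z gives <F x, z> + <F z,
    x> = 0 in real part, the imaginary form at x + i z gives <F x, z> - <F z, x> = 0. *)
Lemma fc_ortho B x z : measurable B -> E B x = x -> E (~` B) z = z ->
  rdot (F x) z = 0.
Proof.
move=> mB Bx.
have additive (g : R -> R) y : measurable_fun setT g -> (forall t, `|g t| <= M) ->
    E (~` B) y = y -> \int[scalar_measure E (x + y)]_t g t =
    \int[scalar_measure E x]_t g t + \int[scalar_measure E y]_t g t.
  move=> mg gM By; apply: pvm_integralD By _ _ => //.
    by apply: (pvm_integrable (B := setT) (M := M)) => //; exact: pvmT.
  by apply: (pvm_integrable (B := setT) (M := M)) => //; exact: pvmT.
move=> Bz; have Biz : E (~` B) ('i%C *: z) = 'i%C *: z.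
  by rewrite pvmZ ?Bz//; exact: measurableC.
have := fc_formRe (x + z); rewrite additive// -!fc_formRe.
have := fc_formIm (x + 'i%C *: z).
rewrite additive// opprD -!fc_formIm !fcD !scalerDr !(rdotDl, rdotDr).
have -> : rdot ('i%C *: F x) ('i%C *: z) = rdot (F x) z.
  by rewrite rdot_iZr scalerA -expr2 sqr_i scaleN1r rdotNl opprK.
have -> : rdot ('i%C *: F ('i%C *: z)) x = - rdot (F z) x.
  by rewrite fcZ scalerA -expr2 sqr_i scaleN1r rdotNl.
lra.
Qed.

Lemma fc_range B x : measurable B -> E B x = x -> E B (F x) = F x.
Proof.
move=> mB Bx; apply: pvm_setC_eq0 => //; have mBC := measurableC mB.
apply: norm2_le0; rewrite /norm2 rdot_pvm// pvm_idem// (fc_ortho mB Bx)//.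
exact: pvm_idem.
Qed.

Lemma fc_pvm B x : measurable B -> E B (F x) = F (E B x).
Proof.
move=> mB; have mBC := measurableC mB.
have Bx := fc_range mB (pvm_idem E x mB).
have BCx := fc_range mBC (pvm_idem E x mBC).
rewrite -{1}(pvm_setC E x mB) fcD pvmD// Bx -BCx pvm_disj ?addr0//.
by rewrite setICr.
Qed.

(** On the range of [E B], the real and imaginary forms of F - c integrate Re (f - c) and Im (f -
    c), so [form_bound] applies with r = e. *)
Lemma fc_bound B x (c : R[i]) (e : R) : measurable B -> 0 < e ->
  (forall t, B t -> `|complex.Re (f t - c)| <= e /\ `|complex.Im (f t - c)| <= e) ->
  E B x = x -> norm2 (F x - c *: x) <= 4 * e ^+ 2 * norm2 x.
Proof.
move=> mB e0 fc Bx.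
apply: (@form_bound _ _ [set x | E B x = x] (fun x => F x - c *: x)) => //=.
- move=> a y z; rewrite linF !scalerDr scalerN !scalerA [c * a]mulrC opprD.
  by rewrite addrACA.
- by move=> y z a By Bz; rewrite pvmP// By Bz.
- by move=> y By; rewrite pvmD// pvmN// pvmZ// By fc_range.
- move=> y By; rewrite rdotDl rdotNl fc_formRe {1}/rdot innerZl inner_norm2.
  have -> : complex.Re (c * (norm2 y)%:C%C) = complex.Re c * norm2 y.
    by case: c {fc} => a b /=; rewrite mulr0 subr0.
  have := pvm_integral_bounds (m := complex.Re c - e) (M := complex.Re c + e) mB By mRe.
  move=> /(_ _)/andP[t Bt|h1 h2].
    by have [] := fc _ Bt; rewrite raddfB /= ler_norml => /andP[]; lra.
  by rewrite ler_norml; lra.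
move=> y By; rewrite scalerDr scalerN rdotDl rdotNl fc_formIm rdot_iZl innerZl.
rewrite inner_norm2.
have -> : complex.Im (c * (norm2 y)%:C%C) = complex.Im c * norm2 y.
  by case: c {fc} => a b /=; rewrite mulr0 add0r.
have := pvm_integral_bounds (m := complex.Im c - e) (M := complex.Im c + e) mB By mIm.
move=> /(_ _)/andP[t Bt|h1 h2].
  by have [_] := fc _ Bt; rewrite raddfB /= ler_norml => /andP[]; lra.
by rewrite ler_norml; lra.
Qed.

End functional_calculus_form.

(** * Orthogonal pieces and partitions of small oscillation *)

Lemma norm2_sum_pvm (R : realType) (H : hilbertSpace R)
    (E : projection_valued_measure H) (A : (set R)^nat) n (x : H) :
  (forall k, measurable (A k)) -> trivIset setT A ->
  norm2 (\sum_(0 <= k < n) E (A k) x) = \sum_(0 <= k < n) norm2 (E (A k) x).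
Proof.
move=> mA tA; apply: (@complexI R); rewrite norm2E norm2_pvm_sum//.
by rewrite rmorph_sum; apply: eq_bigr => k _; rewrite /= norm2E.
Qed.

Lemma measurable_fun_abs_lt (R : realType) (g : R -> R) (a e : R) :
  measurable_fun setT g -> measurable [set t | `|g t - a| < e].
Proof.
move=> mg; rewrite (_ : [set _ | _] = g @^-1` `]a - e, a + e[%classic).
  rewrite -[X in measurable X]setTI; apply: mg => //; exact: measurable_itv.
by apply/seteqP; split=> t /=; rewrite in_itv /= ltr_distl.
Qed.

Lemma small_oscillation_partition (R : realType) (f : R -> R[i]) (e : R) :
  measurable_fun setT (fun t => complex.Re (f t)) ->
  measurable_fun setT (fun t => complex.Im (f t)) -> 0 < e ->
  exists D : (set R)^nat, [/\ forall k, measurable (D k), trivIset setT D,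
    \bigcup_k D k = setT & forall k, exists c, forall t, D k t ->
      `|complex.Re (f t - c)| <= e /\ `|complex.Im (f t - c)| <= e].
Proof.
move=> mRe mIm e0.
(* Preimages of open squares of half-side e around the rational points of the plane, enumerated by
   [pickle] and made disjoint by [seqDU]; non-codes give the empty set. *)
pose U k := if unpickle k is Some (p, q) then
  [set t | `|complex.Re (f t) - ratr p| < e] `&`
  [set t | `|complex.Im (f t) - ratr q| < e] else set0.
have mU k : measurable (U k).
  rewrite /U; case: unpickle => [[p q]|//].
  by apply: measurableI; exact: measurable_fun_abs_lt.
exists (seqDU U); split.
- by move=> k; apply: measurableD => //; exact: bigsetU_measurable.
- exact: trivIset_seqDU.
- rewrite -seqDU_bigcup_eq -subTset => t _.
  have near_rat (a : R) : exists p : rat, `|a - ratr p| < e.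
    have [|p] := @rat_in_itvoo _ (a - e) (a + e); first lra.
    by rewrite in_itv /= -ltr_distl distrC => ?; exists p.
  have [p hp] := near_rat (complex.Re (f t)).
  have [q hq] := near_rat (complex.Im (f t)).
  exists (pickle (p, q)); first exact: I.
  by rewrite /U pickleK; split.
move=> k; suff [c Uc] : exists c, forall t, U k t ->
    `|complex.Re (f t - c)| <= e /\ `|complex.Im (f t - c)| <= e.
  by exists c => t [/Uc].
rewrite /U; case: unpickle => [[p q]|]; last by exists 0.
exists (Complex (ratr p) (ratr q)) => t [/= h1 h2].
by rewrite !raddfB /= !ltW.
Qed.

(** * Commutation of T with the functional calculus up to the parity sign *)

Section intertwining.
Context {R : realType} {H : hilbertSpace R}.
Variables (E : projection_valued_measure H) (f : R -> R[i]) (F : H -> H).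
Hypothesis mRe : measurable_fun setT (fun t => complex.Re (f t)).
Hypothesis mIm : measurable_fun setT (fun t => complex.Im (f t)).
Variable M : R.
Hypothesis ReM : forall t, `|complex.Re (f t)| <= M.
Hypothesis ImM : forall t, `|complex.Im (f t)| <= M.
Hypothesis linF : linear F.
Hypothesis formF : forall x, inner (F x) x = spectral_integral E f x.
Variable T : {linear H -> H}.
Hypothesis cT : continuous T.
Hypothesis TE : forall B x, measurable B -> T (E B x) = E (-%R @^-1` B) (T x).

Lemma fc_parity (b : bool) : (forall t, f (- t) = (-1) ^+ b * f t) ->
  forall x, T (F x) = (-1) ^+ b *: F (T x).
Proof.
move=> fb x; apply/eqP; rewrite -subr_eq0; apply/eqP/norm2_le0.
pose W y := T (F y) - (-1) ^+ b *: F (T y); rewrite -/(W x).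
have bb : (-1) ^+ b * (-1) ^+ b = 1 :> R[i] by rewrite -expr2 sqrr_sign.
have norm2b (y : H) : norm2 ((-1) ^+ b *: y) = norm2 y.
  by rewrite scaler_sign; case: b {fb W bb} => //; rewrite norm2N.
have [K K0 TK] := continuous_norm2_bound cT.
have EF B y mB := fc_pvm mRe mIm ReM ImM linF formF (B := B) y mB.
have WE B y : measurable B -> W (E B y) = E (-%R @^-1` B) (W y).
  move=> mB; have mN := measurable_opp_preimage mB.
  by rewrite /W -EF// !TE// -EF// pvmD// pvmN// pvmZ.
(* If f is near c on B, parity puts it near (-1)^b c on -B, where T y lives. These scalars cancel in
   W y; each of the two remainders contributes 2 * 4 K e^2, hence 16. *)
have loc B (c : R[i]) (e : R) y : measurable B -> 0 < e -> (forall t, B t ->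
    `|complex.Re (f t - c)| <= e /\ `|complex.Im (f t - c)| <= e) ->
    E B y = y -> norm2 (W y) <= 16 * K * e ^+ 2 * norm2 y.
  move=> mB e0 fc By; have mN := measurable_opp_preimage mB.
  have NTy : E (-%R @^-1` B) (T y) = T y by rewrite -TE// By.
  have fNc (t : R) : (-%R @^-1` B) t ->
      `|complex.Re (f t - (-1) ^+ b * c)| <= e /\
      `|complex.Im (f t - (-1) ^+ b * c)| <= e.
    move=> /fc; rewrite fb.
    have -> : (-1) ^+ b * f t - c = (-1) ^+ b * (f t - (-1) ^+ b * c).
      by rewrite mulrBr mulrA bb mul1r.
    case: b {fb W bb norm2b EF WE} => /=; last by rewrite mul1r.
    by rewrite expr1 !mulN1r opprK; case: (f t + c) => p q /=; rewrite !normrN.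
  have b1 := fc_bound mRe mIm ReM ImM linF formF mB e0 fc By.
  have b2 := fc_bound mRe mIm ReM ImM linF formF mN e0 fNc NTy.
  have -> : W y = T (F y - c *: y) -
      (-1) ^+ b *: (F (T y) - ((-1) ^+ b * c) *: T y).
    rewrite /W linearB [T (c *: y)]linearZ /= scalerBr scalerA mulrA bb mul1r.
    by rewrite opprB addrA subrK.
  apply: le_trans (norm2D_le _ _) _; rewrite norm2N norm2b.
  have h1 := le_trans (TK _) (ler_wpM2l K0 b1).
  have h2 : norm2 (F (T y) - ((-1) ^+ b * c) *: T y) <= 4 * e ^+ 2 * (K * norm2 y).
    apply: le_trans b2 _; apply: ler_wpM2l (TK y).
    by rewrite mulr_ge0 ?sqr_ge0.
  lra.
(* Taking e = 2^-n makes the bound geometric in n. *)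
suff bound (e : R) : 0 < e -> norm2 (W x) <= 16 * K * e ^+ 2 * norm2 x.
  apply: (@le_geometric_le0 _ _ (16 * K * norm2 x) (2^-1 ^+ 2)) => [|n].
    by rewrite sqr_ge0 /= expr2; lra.
  have := bound (2^-1 ^+ n); rewrite exprn_gt0// => /(_ isT).
  by rewrite exprAC mulrAC.
move=> e0; have [D [mD tD UD oscD]] := small_oscillation_partition mRe mIm e0.
pose ND k := -%R @^-1` D k.
have mND k : measurable (ND k) by exact: measurable_opp_preimage.
have tND : trivIset setT ND by move=> i j _ _ [t tij]; apply: tD => //; exists (- t).
have UND : \bigcup_k ND k = setT by rewrite /ND -preimage_bigcup UD preimage_setT.
have cW := cvg_norm2 (@pvm_sigma_additive _ _ E _ mND tND (W x)).
have cx := cvg_norm2 (@pvm_sigma_additive _ _ E _ mD tD x).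
rewrite UND pvmT in cW; rewrite UD pvmT in cx.
have cx' : (16 * K * e ^+ 2) * norm2 (\sum_(0 <= k < n) E (D k) x) @[n --> \oo]
    --> (16 * K * e ^+ 2) * norm2 x.
  by apply: cvgMr.
rewrite -(cvg_lim _ cW)// -(cvg_lim _ cx')//.
apply: ler_lim; [exact: cvgP cW|exact: cvgP cx'|apply: nearW => n].
(* Pythagoras for the pieces [ND k] of W x and [D k] of x; [WE] matches them, and [loc] compares
   them one by one. *)
rewrite !norm2_sum_pvm// mulr_sumr; apply: ler_sum => k _.
have [c fc] := oscD k; rewrite -WE//; apply: loc fc _ => //; exact: pvm_idem.
Qed.

End intertwining.

(** * Odd and even continuous bounded functions of D *)

Lemma continuous_Re (R : realType) (f : R -> R[i]) :
  continuous f -> continuous (fun t => complex.Re (f t)).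
Proof.
move=> cf t; apply/cvgrPdist_lt => e e0.
have /cvgrPdist_lt/(_ (e%:C)%C) := cf t; rewrite (ltcR 0 e) => /(_ e0).
apply: filterS => u; rewrite -(ltcR _ e); apply: le_lt_trans.
by rewrite (le_trans _ (normc_ge_Re _))// raddfB.
Qed.

Lemma continuous_Im (R : realType) (f : R -> R[i]) :
  continuous f -> continuous (fun t => complex.Im (f t)).
Proof.
move=> cf; rewrite (_ : (fun t => _) = fun t => complex.Re (- 'i%C * f t)).
  by apply: continuous_Re => t; apply: cvgMr; exact: cf.
by apply/funext => t; case: (f t) => a b /=; rewrite oppr0 mul0r sub0r mulN1r opprK.
Qed.

Theorem lemma3p5 (R : realType) (H : hilbertSpace R) (D : operator H)
  (D_dense : dense (dom D))
  (D_esa : essentially_self_adjoint D)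
  (T : {linear H -> H}) (T_bounded : continuous T)
  (T_dom : forall x : H, dom D x -> dom D (T x))
  (T_anti : forall x : H, dom D x -> T (D x) = - D (T x))
  (f : R -> R[i]) (f_cont : continuous f) (f_bounded : bounded_fun f) :
  ((forall t : R, f (- t) = - f t) ->
     forall x : H,
       T (functional_calculus D f x) = - functional_calculus D f (T x)) /\
  ((forall t : R, f (- t) = f t) ->
     forall x : H,
       T (functional_calculus D f x) = functional_calculus D f (T x)).
Proof.
(* In the default branch of [xget] the map is 0 and both identities reduce to T 0 = 0. *)
rewrite /functional_calculus; case: xgetP => [F _ [linF _ [E ED formF]]|_]; last first.
  by split=> _ x; rewrite linear0 ?oppr0.
have mRe : measurable_fun setT (fun t => complex.Re (f t)).
  by apply: continuous_measurable_fun; exact: continuous_Re.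
have mIm : measurable_fun setT (fun t => complex.Im (f t)).
  by apply: continuous_measurable_fun; exact: continuous_Im.
have [M fM] : exists M : R, forall t, `|f t| <= M%:C%C.
  have [M [Mreal fM]] := f_bounded.
  (* [bounded_fun] bounds |f| by every number strictly above [M], whence the + 1. *)
  exists (complex.Re M + 1) => t; rewrite raddfD /= RRe_real//.
  by apply: fM => //; rewrite ltrDl.
have ReM t : `|complex.Re (f t)| <= M.
  by rewrite -lecR; exact: le_trans (normc_ge_Re _) (fM t).
have ImM t : `|complex.Im (f t)| <= M.
  rewrite -lecR; apply: le_trans (fM t).
  have := normc_ge_Re (f t * 'i%C); rewrite ReiNIm normrN normrM.
  suff -> : `|'i%C : R[i]| = 1 by rewrite mulr1.
  by rewrite normc_def /= expr0n expr1n add0r sqrtr1.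
have TE := reflects_comm ED (@closure_graphP _ _ D) T_bounded
  (closure_graph_anticomm T_bounded T_dom T_anti).
have par := fc_parity mRe mIm ReM ImM linF formF T_bounded TE.
split=> fN x.
  have fs t : f (- t) = (-1) ^+ true * f t by rewrite fN mulr_sign.
  by rewrite (par _ fs) scaler_sign.
have fs t : f (- t) = (-1) ^+ false * f t by rewrite fN mulr_sign.
by rewrite (par _ fs) scaler_sign.
Qed.
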